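(* Let $G$ be a graph and let $G'$ be the result of contracting $G$ via the graph contraction algorithm described in the context. A minimum power dominating set of $G'$ corresponds to a minimum power dominating set of $G$. Therefore, $\gamma_P(G)=\gamma_P(G')$.
   Context: A graph $G$ consists of a set of vertices $V(G)$ and a set $E(G)$ of unordered pairs of vertices, called edges. Two vertices are adjacent if there is an edge between them. The degree $\deg_G(v)$ of a vertex $v$ is the number of vertices adjacent to $v$ in $G$. A leaf is a vertex of degree one, and an isolated vertex is a vertex of degree zero. For $A\subseteq V(G)$, $G[A]$ is the vertex-induced subgraph with vertex set $A$ and edge set $\{xy\in E(G): x,y\in A\}$. Power domination. The power domination algorithm with input $S\subseteq V(G)$ is: (1) (domination step) each vertex in $S$, or adjacent to a vertex in $S$, is observed; (2) (zero forcing step) while there exists an observed vertex adjacent to exactly one unobserved vertex, that unobserved vertex becomes observed. The set of observed vertices after applying this algorithm is $\operatorname{Obs}(G;S)$. A power dominating set of $G$ is any $S\subseteq V(G)$ with $\operatorname{Obs}(G;S)=V(G)$. The power domination number $\gamma_P(G)$ is the cardinality of a minimum power dominating set of $G$, i.e. one of smallest cardinality. Edge contraction. For an edge $xy\in E(G)$, an edge contraction on $xy$ adds a new vertex $z$ to $G$ adjacent to any vertex adjacent to either $x$ or $y$, and removes $x$ and $y$ from $G$ as well as any edges incident to $x$ or $y$. Graph contraction algorithm. Input: a graph $G$. Output: a contracted graph $G'$. For each connected component $H$ of $G[\{v\in V(G):\deg_G(v)<3\}]$: (i) if $H$ is a path terminating in two leaves, or $H$ is a cycle, contract the path or cycle in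 $G$ corresponding to $H$ to an isolated vertex; (ii) if $H$ is a path terminating in vertices adjacent in $G$ to distinct vertices $x,y$ with $\deg_G(x)\ge 3$ and $\deg_G(y)\ge 3$, contract the path in $G$ corresponding to $H$ to a single degree 2 vertex; (iii) if $H$ is a path terminating in a leaf and a vertex adjacent in $G$ to a vertex $x$ with $\deg_G(x)\ge 3$, contract the path in $G$ corresponding to $H$ to a leaf; (iv) if $H$ is a path terminating in vertices adjacent in $G$ to a single vertex $x$ with $\deg_G(x)\ge 3$, contract the path in $G$ corresponding to $H$ to a pair of adjacent degree 2 vertices. *)

(* Defs.v *)
From mathcomp Require Import all_boot.

Set Implicit Arguments.
Unset Strict Implicit.
Unset Printing Implicit Defensive.

Record sgraph := SGraph {
  vertex :> finType;
  adj : rel vertex;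
  adj_sym : symmetric adj;
  adj_irrefl : irreflexive adj
}.

Notation "x -- y" := (adj x y) (at level 30, no associativity).

Section Degree.
Variable G : sgraph.

Definition deg (v : G) : nat := #|[set w | v -- w]|.

Definition is_leaf (v : G) : bool := deg v == 1.
Definition is_isolated (v : G) : bool := deg v == 0.

(* The edges of G[A]; its vertices are those of A. *)
Definition induced_adj (A : {set G}) : rel G :=
  [rel x y | [&& x \in A, y \in A & x -- y]].

Definition components (A : {set G}) : {set {set G}} :=
  equivalence_partition (connect (induced_adj A)) A.

End Degree.

Section PowerDomination.
Variable G : sgraph.
Implicit Types S B : {set G}.

Definition domination_step S : {set G} :=
  [set v | (v \in S) || [exists u in S, u -- v]].

Definition unobserved_nbrs B (u : G) : {set G} := [set w | u -- w & w \notin B].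

Definition forceable B (v : G) : bool :=
  [exists u in B, unobserved_nbrs B u == [set v]].

Definition zero_forcing_step B : {set G} :=
  if [pick v | forceable B v] is Some v then v |: B else B.

(* The "while" loop: every effective step adds a vertex, so it has stopped
   after #|G| rounds. *)
Definition Obs S : {set G} := iter #|G| zero_forcing_step (domination_step S).

Definition power_dominating S : bool := Obs S == [set: G].

Definition min_power_dominating S : Prop :=
  power_dominating S /\ forall T : {set G}, power_dominating T -> #|S| <= #|T|.

End PowerDomination.

(* [set: G] is always power dominating, so it is a legitimate default for the
   minimum. *)
Definition gammaP (G : sgraph) : nat :=
  #|[arg min_(S < [set: G] | power_dominating S) #|S|]|.

Section EdgeContraction.
Variables (G : sgraph) (x y : G).

(* [None] is the new vertex; [Some] ranges over the vertices other than x, y. *)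
Definition ec_vertex : finType := option {v : G | (v != x) && (v != y)}.

Definition ec_adj : rel ec_vertex := fun a b =>
  match a, b with
  | Some u, Some v => val u -- val v
  | None, Some v | Some v, None => (x -- val v) || (y -- val v)
  | None, None => false
  end.

Lemma ec_adj_sym : symmetric ec_adj.
Proof. by move=> [u|] [v|] //=; rewrite adj_sym. Qed.

Lemma ec_adj_irrefl : irreflexive ec_adj.
Proof. by move=> [u|] //=; rewrite adj_irrefl. Qed.

Definition edge_contraction : sgraph := SGraph ec_adj_sym ec_adj_irrefl.

(* Sends x and y to the new vertex and every other vertex to itself. *)
Definition ec_map (v : G) : edge_contraction := insub v.

End EdgeContraction.

Section ContractionAlgorithm.
Variable G : sgraph.
Implicit Types H : {set G}.

(* An intermediate graph, together with the map recording the vertex into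
   which each original vertex has been merged. *)
Record contraction := Contraction {
  cgraph : sgraph;
  cmap : G -> cgraph
}.

Definition no_contraction : contraction := @Contraction G id.

Definition contract_edge (C : contraction) (x y : cgraph C) : contraction :=
  @Contraction (edge_contraction x y) (fun v => ec_map x y (cmap C v)).

(* C' arises from C by successively contracting edges inside the current
   image of H. *)
Inductive contracts_in H : contraction -> contraction -> Prop :=
| contracts_done C : contracts_in H C C
| contracts_edge C C' (a b : G) :
    a \in H -> b \in H -> cmap C a -- cmap C b ->
    contracts_in H (contract_edge (cmap C a) (cmap C b)) C' ->
    contracts_in H C C'.

(* G[H] is a path graph with ends p and q (p = q when it has one vertex). *)
Definition is_path H (p q : G) : Prop :=
  exists s : seq G,
    [/\ uniq (p :: s), last p s = q, H = [set:: p :: s] &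
        {in H &, forall u v : G,
          u -- v = (index v (p :: s) == (index u (p :: s)).+1)
                || (index u (p :: s) == (index v (p :: s)).+1)}].

(* G[H] is a cycle graph. *)
Definition is_cycle H : Prop :=
  exists s : seq G,
    [/\ uniq s, 2 < size s, H = [set:: s] &
        {in H &, forall u v : G, u -- v = (v == next s u) || (u == next s v)}].

(* In the first and the last case the two ends are distinct; in the other two
   the path may consist of a single vertex. *)
Definition path_two_leaves H : Prop :=
  exists p q : G, [/\ is_path H p q, p != q, is_leaf p & is_leaf q].

Definition path_distinct_branch H : Prop :=
  exists p q x y : G,
    [/\ is_path H p q, p -- x /\ q -- y, x != y, 3 <= deg x & 3 <= deg y].

Definition path_leaf_branch H : Prop :=
  exists p q x : G, [/\ is_path H p q, is_leaf p, q -- x & 3 <= deg x].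

Definition path_same_branch H : Prop :=
  exists p q x : G,
    [/\ is_path H p q, p != q, p -- x, q -- x & 3 <= deg x].

Inductive process H (C C' : contraction) : Prop :=
| process_isolated :
    path_two_leaves H \/ is_cycle H ->
    contracts_in H C C' ->
    (exists2 z, cmap C' @: H = [set z] & is_isolated z) ->
    process H C C'
| process_degree2 :
    path_distinct_branch H ->
    contracts_in H C C' ->
    (exists2 z, cmap C' @: H = [set z] & deg z = 2) ->
    process H C C'
| process_leaf :
    path_leaf_branch H ->
    contracts_in H C C' ->
    (exists2 z, cmap C' @: H = [set z] & is_leaf z) ->
    process H C C'
| process_pair :
    path_same_branch H ->
    contracts_in H C C' ->
    (exists z1 z2, [/\ cmap C' @: H = [set z1; z2], z1 -- z2,
                       deg z1 = 2 & deg z2 = 2]) ->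
    process H C C'
(* Only isolated vertices of G fall under none of the cases. *)
| process_skip :
    ~ path_two_leaves H -> ~ is_cycle H -> ~ path_distinct_branch H ->
    ~ path_leaf_branch H -> ~ path_same_branch H ->
    C' = C -> process H C C'.

Inductive process_all : seq {set G} -> contraction -> contraction -> Prop :=
| process_all_nil C : process_all [::] C C
| process_all_cons H Hs C C' C'' :
    process H C C' -> process_all Hs C' C'' -> process_all (H :: Hs) C C''.

Definition low_degree : {set G} := [set v | deg v < 3].

(* R is a possible output: the components are processed in any order, and the
   edges of each are contracted in any order. *)
Definition contraction_algorithm (R : contraction) : Prop :=
  exists Hs : seq {set G},
    [/\ uniq Hs, Hs =i components low_degree & process_all Hs no_contraction R].

End ContractionAlgorithm.

(* Main.v *)
Require Import Defs.
From mathcomp Require Import all_boot.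

Set Implicit Arguments.
Unset Strict Implicit.
Unset Printing Implicit Defensive.

(** Let f : G -> G' be the map that records the contraction. The theorem
    follows from: S is power dominating in G if and only if f @: S is power
    dominating in G'. Indeed a minimum S' then lifts to the set of arbitrarily
    chosen preimages of its elements, and a power dominating T of G satisfies
    #|S'| <= #|f @: T| <= #|T|.

    The equivalence rests on one remark ([Obs_low_degree]): all neighbours of
    an observed vertex of degree at most two are observed. For if the vertex is
    not in the input set, it became observed through an observed neighbour, so
    that at most one neighbour is left, and it gets forced. Hence observation
    spreads through a connected set of low-degree vertices and to everything
    adjacent to it, whichever of its vertices comes first; such a set may as
    well be shrunk.

    What has to be known about f is that a fibre with several elements is a
    connected set of low-degree vertices and has a low-degree image, and that f
    is injective on the neighbours of each vertex x of degree at least three.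
    The last condition makes x force the same way in G and in G': if two
    neighbours of x were merged, x could force in G' but not in G. Under these
    conditions [power_dominating_lift] and [power_dominating_image] transport
    an execution of the algorithm in each direction.

    That the contraction algorithm yields such an f is proved by induction on
    the components processed so far, with the invariant [tame]. Injectivity on
    neighbours is where the cases of the algorithm differ. Nothing outside H is
    adjacent to a component H that ends up isolated. Otherwise H is a path, and
    two of its vertices with a common neighbour x outside H have to be its two
    ends. This cannot happen if one end is a leaf or if the ends are attached to
    distinct branch vertices. If both ends are attached to x, merging them would
    leave the other one of the two final vertices without any neighbour except
    the merged one, so its degree could not be two; this is the reason why the
    algorithm keeps a pair of vertices there. *)

(** * Observed vertices *)

Section Observed.
Variable G : sgraph.
Implicit Types (S B : {set G}) (u v w : G).

Lemma deg_gt2 v a b c :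
  v -- a -> v -- b -> v -- c -> a != b -> b != c -> c != a -> 2 < deg v.
Proof.
move=> va vb vc ab bc ca; apply/card_gt2P; exists a, b, c.
by split; split=> //; rewrite inE.
Qed.

Lemma deg_low v a b c :
  deg v < 3 -> v -- a -> v -- b -> v -- c -> a != b -> b != c -> c = a.
Proof.
move=> dv va vb vc ab bc; apply/eqP/idPn => ca.
by have := deg_gt2 va vb vc ab bc ca; rewrite ltnNge -ltnS dv.
Qed.

Definition zf_closed B := forall u v, u \in B -> u -- v ->
  (forall w, u -- w -> w \notin B -> w = v) -> v \in B.

Lemma forceableP B v :
  reflect (exists u, [/\ u \in B, u -- v, v \notin B &
                         forall w, u -- w -> w \notin B -> w = v])
          (forceable B v).
Proof.
apply: (iffP existsP) => [[u /andP[uB /eqP E]]|[u [uB uv vB h]]]; exists u.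
  have : v \in unobserved_nbrs B u by rewrite E inE.
  rewrite inE => /andP[uv vB]; split=> // w uw wB.
  by apply/set1P; rewrite -E inE uw.
rewrite uB /=; apply/eqP/setP => w; rewrite !inE; apply/andP/eqP => [[]|->//].
exact: h.
Qed.

Lemma zero_forcing_step_sub B : B \subset zero_forcing_step B.
Proof.
by rewrite /zero_forcing_step; case: pickP => // v _; apply: subsetUr.
Qed.

(** An idle round would be followed by idle rounds only; so each of the n rounds
    before a forceable vertex has added a vertex. *)
Lemma iter_zero_forcing_card n B v :
  forceable (iter n (@zero_forcing_step G) B) v ->
  n <= #|iter n (@zero_forcing_step G) B|.
Proof.
elim: n v => [//|n IHn] v /=; set C := iter n _ B in IHn *.
rewrite /zero_forcing_step; case: pickP => [w fw _|/(_ v)-> //].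
have /forceableP[u [_ _ wC _]] := fw.
by rewrite cardsU1 wC add1n ltnS (IHn w fw).
Qed.

(** Each effective round adds a vertex, so if some vertex could still be forced
    after #|G| rounds, all vertices would be observed, including that one. *)
Lemma Obs_closed S : zf_closed (Obs S).
Proof.
move=> u v uO uv h; apply/idPn => vO.
have fv : forceable (Obs S) v by apply/forceableP; exists u.
have OT : Obs S = [set: G].
  by apply/eqP; rewrite eqEcard subsetT cardsT (iter_zero_forcing_card fv).
by rewrite OT inE in vO.
Qed.

Lemma domination_sub_Obs S : domination_step S \subset Obs S.
Proof.
rewrite /Obs; elim: #|G| => //= n IHn.
exact: subset_trans IHn (zero_forcing_step_sub _).
Qed.

Lemma mem_Obs S u : u \in S -> u \in Obs S.
Proof.
by move=> uS; apply: (subsetP (domination_sub_Obs S)); rewrite inE uS.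
Qed.

Lemma nbr_Obs S u v : u \in S -> u -- v -> v \in Obs S.
Proof.
move=> uS uv; apply: (subsetP (domination_sub_Obs S)); rewrite inE orbC.
by apply/orP; left; apply/existsP; exists u; rewrite uS.
Qed.

(** Together with [Obs_closed], this frees everything below from the order in
    which vertices are forced: [Obs S] is the least closed set containing the
    dominated vertices. *)
Lemma Obs_min S B :
    {subset S <= B} -> (forall u v, u \in S -> u -- v -> v \in B) ->
    zf_closed B ->
  {subset Obs S <= B}.
Proof.
move=> SB domB clB; rewrite /Obs; elim: #|G| => /= [v|n IHn v].
  by rewrite inE => /orP[/SB//|/existsP[u /andP[uS]]]; apply: domB.
rewrite {1}/zero_forcing_step; case: pickP => [w|_]; last exact: IHn.
case/forceableP=> u [uC uw wC h] /setU1P[->|/IHn//].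
apply: (clB u) => // [|t ut tB]; first exact: IHn.
by apply: h => //; apply: contra tB; apply: IHn.
Qed.

(** A vertex can only become observed through a neighbour that is already
    observed; the set of vertices with this property is closed. *)
Lemma Obs_has_nbr S u :
  u \in Obs S -> u \in S \/ exists2 w, w \in Obs S & u -- w.
Proof.
pose B := [set x in Obs S | (x \in S) || [exists w in Obs S, x -- w]].
suff /(_ u) sB : {subset Obs S <= B}.
  move/sB; rewrite inE => /andP[_ /orP[|/existsP[w /andP[]]]]; first by left.
  by right; exists w.
have inB x w : w \in Obs S -> w -- x -> x \in Obs S -> x \in B.
  move=> wO wx xO; rewrite inE xO; apply/orP; right; apply/existsP.
  by exists w; rewrite wO adj_sym.
apply: Obs_min => [x xS|x v xS xv|x v].
- by rewrite inE mem_Obs // xS.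
- by apply: (inB v x) => //; [apply: mem_Obs|apply: nbr_Obs xv].
rewrite inE => /andP[xO _] xv h; apply: (inB v x) => //.
apply: (Obs_closed xO xv) => w xw wO; apply: h => //.
by rewrite inE (negbTE wO).
Qed.

(** Either u is in S and dominates its neighbours, or one of its at most two
    neighbours is observed and u forces the other one. *)
Lemma Obs_low_degree S u v :
  deg u < 3 -> u \in Obs S -> u -- v -> v \in Obs S.
Proof.
move=> du uO uv; have [uS|[w wO uw]] := Obs_has_nbr uO.
  exact: nbr_Obs uv.
have [<- //|wv] := eqVneq w v.
apply: (Obs_closed uO uv) => t ut tO; apply: (deg_low du uv uw ut).
  by rewrite eq_sym.
by apply: contraNneq tO => <-.
Qed.

Lemma gammaP_min S : min_power_dominating S -> gammaP G = #|S|.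
Proof.
case=> pS minS; rewrite /gammaP; case: arg_minnP => [|T pT minT].
  by apply/eqP/setP => v; rewrite [RHS]inE mem_Obs.
by apply/eqP; rewrite eqn_leq minT ?minS.
Qed.

Lemma min_power_dominating_exists : exists S : {set G}, min_power_dominating S.
Proof.
have pT : power_dominating [set: G].
  by apply/eqP/setP => v; rewrite [RHS]inE mem_Obs.
by case: (arg_minnP (fun S : {set G} => #|S|) pT) => S pS minS; exists S.
Qed.

End Observed.

(** * Contractions that preserve power domination *)

(** Up to isomorphism, K is the quotient of G by a partition into connected
    sets. Connectivity is stated with edges inside fibres, which makes the
    notion stable under composition. *)
Record contraction_map (G K : sgraph) (f : G -> K) : Prop := ContractionMap {
  cm_surj : forall a, exists u, f u = a;
  cm_adj : forall u v, u -- v -> f u != f v -> f u -- f v;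
  cm_lift : forall a b, a -- b -> exists u v, [/\ f u = a, f v = b & u -- v];
  cm_fibre : forall u v, f u = f v ->
    connect [rel x y | (x -- y) && (f x == f y)] u v }.

Section PowerDominationContraction.
Variables (G K : sgraph) (f : G -> K).
Hypothesis f_contr : contraction_map f.
Hypothesis fibre_low : forall u v, f u = f v -> u != v -> deg u < 3.
Hypothesis image_low : forall u v, f u = f v -> u != v -> deg (f u) < 3.
Hypothesis nbr_inj : forall x u v,
  2 < deg x -> x -- u -> x -- v -> f u = f v -> u = v.

(** A nontrivial fibre is connected and of low degree, so observation spreads
    from any of its vertices to the whole fibre. *)
Lemma Obs_fibre (S : {set G}) u v :
  f u = f v -> u \in Obs S -> v \in Obs S.
Proof.
move=> /(cm_fibre f_contr)/connectP[p pth ->] {v}.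
elim: p u pth => //= x p IHp u /andP[/andP[ux /eqP fux] pth] uO.
apply: (IHp x pth); apply: (Obs_low_degree _ uO ux).
by apply: (fibre_low fux); apply: contraTneq ux => ->; rewrite adj_irrefl.
Qed.

Lemma high_fibre u v : f u = f v -> 2 < deg u -> v = u.
Proof.
move=> fuv du; apply/eqP; rewrite eq_sym; apply/idPn => uv.
by have := fibre_low fuv uv; rewrite ltnNge -ltnS ltnS du.
Qed.

(** The image of [Obs S] is closed in K. When a forces b along an edge lifted to
    x -- y, either x has low degree and [Obs_low_degree] gives y, or x is alone
    in its fibre and its neighbours have distinct images, so that x forces y for
    the same reason as a forces b. *)
Lemma power_dominating_lift (S : {set G}) :
  power_dominating (f @: S) -> power_dominating S.
Proof.
move/eqP=> fST; apply/eqP/setP => v; rewrite [RHS]inE.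
suff /(_ (f v)) sub : {subset Obs (f @: S) <= f @: Obs S}.
  have /sub/imsetP[u uO /esym fuv] : f v \in Obs (f @: S) by rewrite fST inE.
  exact: Obs_fibre uO.
apply: Obs_min => [a /imsetP[u uS ->]|a b /imsetP[u uS ->]|a b].
- by rewrite imset_f ?mem_Obs.
- case/(cm_lift f_contr)=> x [y [fxu <- xy]]; apply: imset_f.
  have [dx|dx] := ltnP (deg x) 3.
    apply: (Obs_low_degree dx _ xy).
    exact: Obs_fibre (esym fxu) (mem_Obs uS).
  by apply: nbr_Obs xy; rewrite -(high_fibre fxu dx).
case/imsetP=> u uO -> /(cm_lift f_contr)[x [y [fxu <- xy]]] h.
have xO : x \in Obs S by apply: Obs_fibre (esym fxu) uO.
apply: imset_f; have [dx|dx] := ltnP (deg x) 3.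
  exact: Obs_low_degree xO xy.
apply: (Obs_closed xO xy) => w xw wO; apply: (nbr_inj dx xw xy).
apply: h.
  rewrite -fxu; apply: (cm_adj f_contr) => //.
  by apply: contraTneq xw => /high_fibre->//; rewrite adj_irrefl.
apply: contra wO => /imsetP[t tO /esym ftw]; exact: Obs_fibre tO.
Qed.

(** The preimage of [Obs (f @: S)] is closed in G. When u forces w, either u is
    alone in its fibre and all neighbours of f u except f w are images of
    neighbours of u, or f u has low degree and [Obs_low_degree] applies in K. *)
Lemma power_dominating_image (S : {set G}) :
  power_dominating S -> power_dominating (f @: S).
Proof.
move/eqP=> ST; apply/eqP/setP => a; rewrite [RHS]inE.
have [v <-] := cm_surj f_contr a.
suff /(_ v) : {subset Obs S <= f @^-1: Obs (f @: S)} by rewrite ST !inE => ->.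
apply: Obs_min => [u uS|u w uS uw|u w].
- by rewrite inE mem_Obs ?imset_f.
- rewrite inE; have [<-|fuw] := eqVneq (f u) (f w).
    by rewrite mem_Obs ?imset_f.
  by apply: (nbr_Obs (imset_f f uS)); apply: (cm_adj f_contr).
rewrite !inE => uO uw h; have [<- //|fuw] := eqVneq (f u) (f w).
have fuw' := cm_adj f_contr uw fuw.
apply: (Obs_closed uO fuw') => b fub bO.
have [x [y [fxu fyb xy]]] := cm_lift f_contr fub.
have [exu|exu] := eqVneq x u.
  by rewrite -fyb; congr f; apply: h; rewrite ?inE ?fyb // -exu.
have dfu : deg (f u) < 3 by rewrite -fxu; apply: image_low fxu exu.
by rewrite (Obs_low_degree dfu uO fub) in bO.
Qed.

Lemma min_power_dominating_lift (S' : {set K}) :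
  min_power_dominating S' ->
  exists S : {set G},
    [/\ min_power_dominating S, f @: S = S' & #|S| = #|S'|].
Proof.
case=> pS' minS'.
have ex a : exists u, f u == a by have [u <-] := cm_surj f_contr a; exists u.
pose g a := xchoose (ex a).
have gK : cancel g f by move=> a; apply/eqP/(xchooseP (ex a)).
have fg : f @: (g @: S') = S'.
  by rewrite -imset_comp (eq_imset (g := id)) ?imset_id // => a; apply: gK.
have cg : #|g @: S'| = #|S'| by apply: card_imset (can_inj gK).
exists (g @: S'); split=> //; split=> [|T pT].
  by apply: power_dominating_lift; rewrite fg.
rewrite cg; apply: leq_trans (leq_imset_card f T).
by apply/minS'/power_dominating_image.
Qed.

End PowerDominationContraction.

(** * Edge contractions as contraction maps *)

Section ContractionMaps.

Lemma contraction_map_id (G : sgraph) : contraction_map (@id G).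
Proof.
split=> [a|//|a b ab|u v ->]; last exact: connect0; first by exists a.
by exists a, b.
Qed.

Lemma contraction_map_comp (G K L : sgraph) (f : G -> K) (g : K -> L) :
  contraction_map f -> contraction_map g -> contraction_map (g \o f).
Proof.
move=> cf cg; split=> [a|u v uv|a b ab|u v /=].
- have [b <-] := cm_surj cg a; have [u <-] := cm_surj cf b.
  by exists u.
- move=> /= guv; apply: (cm_adj cg) => //; apply: (cm_adj cf) => //.
  by apply: contra guv => /eqP->.
- have [x [y [<- <- xy]]] := cm_lift cg ab.
  by have [u [v [<- <- uv]]] := cm_lift cf xy; exists u, v.
move=> /(cm_fibre cg)/connectP[p].
have fib x y : f x = f y ->
    connect [rel a b | (a -- b) && (g (f a) == g (f b))] x y.
  move=> /(cm_fibre cf); apply: connect_sub => s t /= /andP[st /eqP fst].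
  by apply: connect1; rewrite /= st fst eqxx.
(* Lift the path of K edge by edge, joining the lifts inside fibres of f. *)
elim: p u => [|b p IHp] u /=; first by move=> _ /esym/fib.
case/andP=> /andP[ub /eqP gub] pth lst.
have [x [y [fx fy xy]]] := cm_lift cf ub.
have ux := fib _ _ (esym fx); apply: connect_trans ux _.
apply: (@connect_trans _ _ y); last by apply: IHp; rewrite fy.
by apply: connect1; rewrite /= xy fx fy gub eqxx.
Qed.

Lemma ec_map_eq (G : sgraph) (x y u v : G) :
  ec_map x y u = ec_map x y v ->
  u = v \/ (u \in [set x; y]) && (v \in [set x; y]).
Proof.
rewrite !inE /ec_map.
case: insubP => [a /= _ <-|]; case: insubP => [b /= _ <-|] //.
  by case=> ->; left.
by rewrite !negb_and !negbK => -> ->; right.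
Qed.

Lemma contraction_map_edge (G : sgraph) (x y : G) :
  x -- y -> contraction_map (ec_map x y).
Proof.
move=> xy.
have end_map v : ec_map x y v = None -> v = x \/ v = y.
  rewrite /ec_map; case: insubP => // + _.
  by rewrite negb_and !negbK => /orP[]/eqP->; [left|right].
have mx : ec_map x y x = None by rewrite /ec_map insubF ?eqxx.
have my : ec_map x y y = None by rewrite /ec_map insubF // eqxx andbF.
have mS a : ec_map x y (val a) = Some a by rewrite /ec_map valK.
split.
- by case=> [a|]; [exists (val a); apply: mS|exists x].
- move=> u v uv.
  case Eu: (ec_map x y u) => [a|]; case Ev: (ec_map x y v) => [b|] //= _.
  + move: Eu Ev; rewrite /ec_map.
    case: insubP => // a' _ eu [<-]; case: insubP => // b' _ ev [<-].
    by rewrite eu ev.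
  + move: Eu; rewrite /ec_map; case: insubP => // a' _ eu [<-]; rewrite eu.
    by case: (end_map v Ev) => <-; rewrite [v -- u]adj_sym uv ?orbT.
  + move: Ev; rewrite /ec_map; case: insubP => // a' _ eu [<-]; rewrite eu.
    by case: (end_map u Eu) => <-; rewrite uv ?orbT.
- case=> [a|] [b|] //= ab.
  + by exists (val a), (val b); rewrite !mS.
  + case/orP: ab => ab; [exists (val a), x|exists (val a), y];
      by rewrite mS adj_sym.
  + by case/orP: ab => ab; [exists x, (val b)|exists y, (val b)]; rewrite mS.
move=> u v E; have [->|] := ec_map_eq E; first exact: connect0.
rewrite !inE => /andP[/orP[]/eqP-> /orP[]/eqP->]; rewrite ?connect0 //.
  by apply: connect1; rewrite /= xy mx my eqxx.
by apply: connect1; rewrite /= adj_sym xy mx my eqxx.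
Qed.

End ContractionMaps.

(** * Paths of low-degree vertices *)

Section Paths.
Variables (G : sgraph) (H : {set G}) (p q : G).
Hypothesis pathH : is_path H p q.
Hypothesis H_low : forall u, u \in H -> deg u < 3.

Lemma is_path_ends : p \in H /\ q \in H.
Proof.
by have [s [_ <- -> _]] := pathH; rewrite !inE eqxx -in_cons mem_last.
Qed.

(** The position along the path; the strict change of rank serves to tell the
    predecessor of u from its successor. *)
Lemma is_path_rank : exists r : G -> nat, forall u, u \in H ->
  (u != q -> exists w, [/\ w \in H, u -- w & r w = (r u).+1]) /\
  (u != p -> exists w, [/\ w \in H, u -- w & (r w).+1 = r u]).
Proof.
have [s [us ls Hs adjH]] := pathH.
exists (index^~ (p :: s)) => u uH.
have up : u \in p :: s by rewrite Hs inE in uH.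
have lu : index u (p :: s) < size (p :: s) by rewrite index_mem.
have nthH i : i < size (p :: s) -> nth p (p :: s) i \in H.
  by move=> li; rewrite Hs inE mem_nth.
split=> [uq|un].
  have li : (index u (p :: s)).+1 < size (p :: s).
    rewrite ltn_neqAle lu andbT; apply: contraNneq uq => ei.
    have e : index u (p :: s) = size s by apply: succn_inj.
    by rewrite -ls (last_nth p) -e nth_index.
  exists (nth p (p :: s) (index u (p :: s)).+1).
  by rewrite adjH ?nthH // index_uniq // eqxx.
have i0 : 0 < index u (p :: s) by rewrite /= eq_sym (negbTE un).
have li : (index u (p :: s)).-1 < size (p :: s).
  by apply: leq_ltn_trans lu; apply: leq_pred.
exists (nth p (p :: s) (index u (p :: s)).-1).
by rewrite adjH ?nthH // index_uniq // prednK // eqxx orbT.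
Qed.

(** An inner vertex already has two neighbours on the path. *)
Lemma is_path_exit u x :
  u \in H -> x \notin H -> u -- x -> u = p \/ u = q.
Proof.
move=> uH xH ux; have [r /(_ u uH)[succ pred]] := is_path_rank.
have [->|up] := eqVneq u p; first by left.
have [->|uq] := eqVneq u q; first by right.
have [a [aH ua ra]] := succ uq; have [b [bH ub rb]] := pred up.
have ab : a != b.
  by apply/eqP => e; move: rb; rewrite -e ra => /eqP; rewrite gtn_eqF // ltnW.
have bx : b != x by apply: contraNneq xH => <-.
by rewrite (deg_low (H_low uH) ua ub ux ab bx) aH in xH.
Qed.

Lemma is_path_inner_nbr u :
  p != q -> u = p \/ u = q -> exists2 w, w \in H & u -- w.
Proof.
move=> pq; have [pH qH] := is_path_ends; have [r hr] := is_path_rank.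
case=> ->.
  by have [/(_ pq)[w [wH pw _]] _] := hr p pH; exists w.
have [_ ] := hr q qH; rewrite eq_sym => /(_ pq)[w [wH qw _]].
by exists w.
Qed.

(** When the two ends differ, each of them has a neighbour on the path, which
    leaves room for a single neighbour outside. *)
Lemma is_path_exit_unique u x y :
  p != q -> u = p \/ u = q -> x \notin H -> y \notin H ->
  u -- x -> u -- y -> x = y.
Proof.
move=> pq upq xH yH ux uy; have [w wH uw] := is_path_inner_nbr pq upq.
have uH : u \in H by have [pH qH] := is_path_ends; case: upq => ->.
have xw : x != w by apply: contraNneq xH => ->.
have wy : w != y by apply: contraNneq yH => <-.
by rewrite (deg_low (H_low uH) ux uw uy xw wy).
Qed.

Lemma is_path_common_nbr u v x :
  u \in H -> v \in H -> u != v -> x \notin H -> u -- x -> v -- x ->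
  [/\ p != q, p -- x, q -- x & u = p /\ v = q \/ u = q /\ v = p].
Proof.
move=> uH vH uv xH ux vx.
have [eu|eu] := is_path_exit uH xH ux; have [ev|ev] := is_path_exit vH xH vx;
  move: uv ux vx; rewrite eu ev ?eqxx //; first by split=> //; left.
by rewrite eq_sym; split=> //; right.
Qed.

End Paths.

(** * The invariant of the contraction algorithm *)

Section Algorithm.
Variable G : sgraph.
Implicit Types (H : {set G}) (C : contraction G) (u v w x : G).

Lemma contracts_in_map H C C' :
  contracts_in H C C' -> contraction_map (cmap C) -> contraction_map (cmap C').
Proof.
elim=> // {}C {}C' a b _ _ ab _ IH cC; apply: IH.
exact: contraction_map_comp cC (contraction_map_edge ab).
Qed.

Lemma contracts_in_coarser H C C' u v :
  contracts_in H C C' -> cmap C u = cmap C v -> cmap C' u = cmap C' v.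
Proof. by elim=> // {}C {}C' a b _ _ _ _ IH e; apply: IH; rewrite /= e. Qed.

Lemma contracts_in_fibre H C C' u v :
  contracts_in H C C' -> cmap C' u = cmap C' v ->
  cmap C u = cmap C v \/
  (cmap C u \in cmap C @: H) && (cmap C v \in cmap C @: H).
Proof.
elim=> {C C'} [C|C C' a b aH bH ab _ IH]; first by left.
have sab t : t \in [set cmap C a; cmap C b] -> t \in cmap C @: H.
  by rewrite !inE => /orP[]/eqP->; apply: imset_f.
have inH t : ec_map (cmap C a) (cmap C b) (cmap C t) \in
    [set ec_map (cmap C a) (cmap C b) (cmap C t') | t' in H] ->
    cmap C t \in cmap C @: H.
  case/imsetP=> t' t'H /ec_map_eq[->|/andP[/sab //]]; exact: imset_f.
move/IH=> [/= /ec_map_eq[|/andP[/sab-> /sab->]]|/andP[/inH-> /inH->]];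
  by [left|right].
Qed.

(** To be instantiated by the components of the low-degree subgraph. *)
Variable P : {set {set G}}.
Hypothesis P_disjoint : forall H1 H2 u,
  H1 \in P -> H2 \in P -> u \in H1 -> u \in H2 -> H1 = H2.
Hypothesis P_low : forall H u, H \in P -> u \in H -> deg u < 3.

Definition share (D : seq {set G}) u v :=
  exists H, [/\ H \in D, H \in P, u \in H & v \in H].

(** The conditions under which power domination is preserved, with the fibres
    localised in the components D that have been processed. This localisation
    guarantees that the remaining components are intact. *)
Record tame (D : seq {set G}) C : Prop := Tame {
  tame_map : contraction_map (cmap C);
  tame_fibre : forall u v, cmap C u = cmap C v -> u != v -> share D u v;
  tame_low : forall u v, cmap C u = cmap C v -> u != v -> deg (cmap C u) < 3;
  tame_inj : forall x u v, 2 < deg x -> x -- u -> x -- v ->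
    cmap C u = cmap C v -> u = v }.

Section Step.
Variables (D : seq {set G}) (H : {set G}) (C C' : contraction G).
Hypotheses (HP : H \in P) (HD : H \notin D) (tameC : tame D C).
Hypothesis cHC : contracts_in H C C'.

Lemma low_H u : u \in H -> deg u < 3.
Proof. exact: P_low. Qed.

Lemma high_notin x : 2 < deg x -> x \notin H.
Proof. by move=> dx; apply/negP => /low_H; rewrite ltnNge dx. Qed.

(** H has not been processed, so C merges its vertices with no other vertex. *)
Lemma image_mem u : cmap C u \in cmap C @: H -> u \in H.
Proof.
case/imsetP=> v vH /(tame_fibre tameC); have [-> //|_] := eqVneq u v.
case=> // K [KD KP _ vK].
by have := HD; rewrite (P_disjoint HP KP vH vK) KD.
Qed.

Lemma step_fibre u v : cmap C' u = cmap C' v -> u != v ->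
  (cmap C u = cmap C v /\ u \notin H /\ v \notin H) \/ (u \in H /\ v \in H).
Proof.
move=> e uv; case: (contracts_in_fibre cHC e) => [e0|/andP[uH vH]]; last first.
  by right; rewrite !image_mem.
left; split=> //.
have [K [KD KP uK vK]] := tame_fibre tameC e0 uv.
by split; apply/negP => tH; move: HD; rewrite (P_disjoint HP KP tH _) ?KD.
Qed.

Lemma step_fibreH u v : cmap C' u = cmap C' v -> u \in H -> v \in H.
Proof.
have [-> //|uv e uH] := eqVneq u v.
by case: (step_fibre e uv) => [[_ []]|[]//]; rewrite uH.
Qed.

(** Processing H can break the invariant only at H. In particular the degree of
    a vertex obtained from an earlier component cannot grow: its fibre is
    unchanged, and vertices separated by C' were separated by C. *)
Lemma tame_step :
  (forall z, z \in cmap C' @: H -> deg z < 3) ->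
  (forall x u v, 2 < deg x -> u \in H -> v \in H -> x -- u -> x -- v ->
     cmap C' u = cmap C' v -> u = v) ->
  tame (H :: D) C'.
Proof.
move=> lowH injH; have cC' := contracts_in_map cHC (tame_map tameC).
split=> // [u v e uv|u v e uv|x u v dx xu xv e].
- case: (step_fibre e uv) => [[e0 _]|[uH vH]].
    have [K [KD KP uK vK]] := tame_fibre tameC e0 uv.
    by exists K; rewrite inE KD orbT.
  by exists H; rewrite inE eqxx.
- case: (step_fibre e uv) => [[e0 [uH _]]|[uH _]]; last first.
    by rewrite lowH ?imset_f.
  rewrite ltnNge; apply/negP => /card_gt2P[a [b [c [[]]]]].
  rewrite !inE => za zb zc [ab bc ca].
  (* Three neighbours of the vertex in C' would come from three in C. *)
  have lift d : cmap C' u -- d ->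
      exists t, cmap C' t = d /\ cmap C u -- cmap C t.
    move=> zd; have [s [t [es et st]]] := cm_lift cC' zd; exists t; split=> //.
    have us : cmap C s = cmap C u.
      have [-> //|su] := eqVneq s u.
      by case: (step_fibre es su) => [[]//|[_]]; rewrite (negbTE uH).
    rewrite -us; apply: (cm_adj (tame_map tameC) st).
    apply: contraTneq zd => /(contracts_in_coarser cHC).
    by rewrite es et => ->; rewrite adj_irrefl.
  have [s [ea us]] := lift a za; have [t [eb ut]] := lift b zb.
  have [r [ec ur]] := lift c zc.
  have sep m n : cmap C' m != cmap C' n -> cmap C m != cmap C n.
    by apply: contra_neq; apply: contracts_in_coarser cHC.
  have := tame_low tameC e0 uv; rewrite ltnNge => /negP; apply.
  by apply: (deg_gt2 us ut ur); apply: sep; rewrite ?ea ?eb ?ec.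
have [//|uv] := eqVneq u v.
case: (step_fibre e uv) => [[e0 _]|[uH vH]]; first exact: (tame_inj tameC dx).
exact: (injH _ _ _ dx uH vH xu xv e).
Qed.

Lemma adj_image x u :
  x \notin H -> u \in H -> x -- u -> cmap C' u -- cmap C' x.
Proof.
move=> xH uH xu; rewrite adj_sym.
apply: (cm_adj (contracts_in_map cHC (tame_map tameC)) xu).
by apply: contraNneq xH => /esym/step_fibreH->.
Qed.

(** No vertex of degree at least three is adjacent to H, as its image would be
    adjacent to the isolated vertex z. *)
Lemma tame_isolated z :
  cmap C' @: H = [set z] -> is_isolated z -> tame (H :: D) C'.
Proof.
move=> eH /eqP dz; have eu u : u \in H -> cmap C' u = z.
  by move=> uH; apply/set1P; rewrite -eH imset_f.
apply: tame_step => [t|x u v dx uH vH xu _ _].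
  by rewrite eH => /set1P->; rewrite dz.
have := adj_image (high_notin dx) uH xu; rewrite eu // => zx.
by move/cards0_eq/setP/(_ (cmap C' x)): dz; rewrite !inE zx.
Qed.

(** A common neighbour of two vertices of H would be the only neighbour outside
    H of both ends, hence equal to both branch vertices. *)
Lemma tame_degree2 z :
  path_distinct_branch H -> cmap C' @: H = [set z] -> deg z = 2 ->
  tame (H :: D) C'.
Proof.
move=> [p [q [a [b [pH [pa qb] ab da db]]]]] eH dz.
apply: tame_step => [t|x u v dx uH vH xu xv _].
  by rewrite eH => /set1P->; rewrite dz.
have [//|uv] := eqVneq u v; rewrite adj_sym in xu; rewrite adj_sym in xv.
have nH := high_notin.
have [pq px qx _] := is_path_common_nbr pH low_H uH vH uv (nH _ dx) xu xv.
have attach t y : t = p \/ t = q -> t -- x -> t -- y -> 2 < deg y -> x = y.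
  move=> tpq tx ty dy.
  by apply: (is_path_exit_unique pH low_H pq tpq) => //; apply: nH.
have xa : x = a by apply: (attach p) => //; left.
have xb : x = b by apply: (attach q) => //; right.
by move: ab; rewrite -xa xb eqxx.
Qed.

(** The two ends would have a common neighbour outside H, but the only neighbour
    of the leaf end is on the path. *)
Lemma tame_leaf z :
  path_leaf_branch H -> cmap C' @: H = [set z] -> is_leaf z ->
  tame (H :: D) C'.
Proof.
move=> [p [q [a [pH leaf_p qa da]]]] eH /eqP dz.
apply: tame_step => [t|x u v dx uH vH xu xv _].
  by rewrite eH => /set1P->; rewrite dz.
have [//|uv] := eqVneq u v; rewrite adj_sym in xu; rewrite adj_sym in xv.
have xH := high_notin dx.
have [pq px _ _] := is_path_common_nbr pH low_H uH vH uv xH xu xv.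
have [w wH pw] := is_path_inner_nbr pH pq (or_introl erefl).
have /cards1P[t /setP et] := leaf_p.
have /set1P ew : w \in [set t] by rewrite -et inE.
have /set1P ex : x \in [set t] by rewrite -et inE.
by rewrite ex -ew wH in xH.
Qed.

(** Two merged neighbours of x would be p and q. Then the other vertex z of the
    final pair comes from inner vertices of the path, whose neighbours are all
    in H, so z has only one neighbour. *)
Lemma tame_pair :
  path_same_branch H ->
  (exists z1 z2, [/\ cmap C' @: H = [set z1; z2], z1 -- z2,
                     deg z1 = 2 & deg z2 = 2]) ->
  tame (H :: D) C'.
Proof.
move=> [p [q [a [pH pq pa qa da]]]] [z1 [z2 [eH zz d1 d2]]].
have cC' := contracts_in_map cHC (tame_map tameC).
apply: tame_step => [t|x u v dx uH vH xu xv e].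
  by rewrite eH !inE => /orP[]/eqP->; rewrite ?d1 ?d2.
have [//|uv] := eqVneq u v; rewrite adj_sym in xu; rewrite adj_sym in xv.
have xH := high_notin dx.
have [_ px qx upq] := is_path_common_nbr pH low_H uH vH uv xH xu xv.
have {e} epq : cmap C' p = cmap C' q by case: upq e => [[-> ->]|[-> ->]].
have [pinH qinH] := is_path_ends pH.
have z12 : z1 != z2 by apply: contraTneq zz => ->; rewrite adj_irrefl.
have [z [zH dz zp]] : exists z,
    [/\ z \in cmap C' @: H, deg z = 2 & cmap C' p != z].
  have : cmap C' p \in [set z1; z2] by rewrite -eH imset_f.
  rewrite !inE => /orP[]/eqP->.
    by exists z2; rewrite eH !inE eqxx orbT.
  by exists z1; rewrite eH !inE eqxx [z2 == z1]eq_sym.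
suff : deg z <= 1 by rewrite dz.
rewrite -(cards1 (cmap C' p)); apply: subset_leq_card; apply/subsetP => b.
rewrite inE => zb; have [s [t [es et st]]] := cm_lift cC' zb.
have sH : s \in H.
  by case/imsetP: zH => w wH ez; apply: step_fibreH wH; rewrite -ez es.
have tH : t \in H.
  apply/idPn => tH; case: (is_path_exit pH low_H sH tH st) => e.
    by rewrite -e es eqxx in zp.
  by rewrite epq -e es eqxx in zp.
have bz : b != z by apply: contraTneq zb => ->; rewrite adj_irrefl.
have bH : b \in cmap C' @: H by rewrite -et imset_f.
have pI : cmap C' p \in cmap C' @: H by rewrite imset_f.
(* Three elements of the pair, with z different from the other two. *)
move: bH zH pI bz zp; rewrite eH !inE.
do 3![case/orP=> /eqP->]; rewrite ?eqxx //.
Qed.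

End Step.

Lemma tame_process D H C C' :
  H \in P -> H \notin D -> tame D C -> process H C C' -> tame (H :: D) C'.
Proof.
move=> HP HD tC.
case=> [_ c [z eH dz]|b c [z eH dz]|b c [z eH dz]|b c zz|_ _ _ _ _ ->].
- exact: (tame_isolated HP HD tC c eH dz).
- exact: (tame_degree2 HP HD tC c b eH dz).
- exact: (tame_leaf HP HD tC c b eH dz).
- exact: (tame_pair HP HD tC c b zz).
case: tC => cm fib low inj; split=> // u v e uv.
have [K [KD KP uK vK]] := fib u v e uv.
by exists K; rewrite inE KD orbT.
Qed.

Lemma tame_process_all Hs D C C' :
  uniq Hs -> {subset Hs <= P} -> (forall H, H \in Hs -> H \notin D) ->
  tame D C -> process_all Hs C C' -> tame (catrev Hs D) C'.
Proof.
move=> + + + + pr; elim: pr D => //= {Hs C C'} H Hs C C' C'' pr _ IH D.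
case/andP=> HHs uHs HsP disj tC; apply: IH => // [K KHs|K KHs|].
- by rewrite HsP // inE KHs orbT.
- rewrite inE negb_or disj ?inE ?KHs ?orbT // andbT.
  by apply: contraNneq HHs => <-.
by apply: tame_process pr; rewrite ?HsP ?disj ?inE ?eqxx.
Qed.

Lemma tame_no_contraction : tame [::] (no_contraction G).
Proof.
by split=> //=; first exact: contraction_map_id; move=> u v -> /eqP.
Qed.

End Algorithm.

(** * Components of the low-degree subgraph *)

Section Components.
Variable G : sgraph.
Implicit Types (H A : {set G}) (u v : G).

Lemma components_partition A : partition (components A) A.
Proof.
apply: equivalence_partitionP => u v w _ _ _; split; first exact: connect0.
move=> uv; apply: (same_connect _ uv); apply: sym_connect_sym => x y /=.
by rewrite /induced_adj /= adj_sym andbCA.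
Qed.

Lemma component_disjoint A H K u :
  H \in components A -> K \in components A -> u \in H -> u \in K -> H = K.
Proof.
have /and3P[_ tI _] := components_partition A.
by move=> HA KA uH uK; rewrite -(def_pblock tI HA uH) (def_pblock tI KA uK).
Qed.

Lemma component_sub A H : H \in components A -> H \subset A.
Proof.
have /and3P[/eqP cA _ _] := components_partition A.
by rewrite -{2}cA; apply: bigcup_sup.
Qed.

End Components.

Theorem theorem4p1 (G : sgraph) (R : contraction G)
    (hR : contraction_algorithm R) :
  (forall S' : {set cgraph R}, min_power_dominating S' ->
     exists S : {set G},
       [/\ min_power_dominating S, cmap R @: S = S' & #|S| = #|S'|])
  /\ gammaP G = gammaP (cgraph R).
Proof.
have low_comp H u : H \in components (low_degree G) -> u \in H -> deg u < 3.
  by move=> /component_sub/subsetP sH /sH; rewrite inE.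
case: hR => Hs [uHs HsP procR].
have [cm fib low inj] : tame (components (low_degree G)) (catrev Hs [::]) R.
  apply: tame_process_all procR => //; first exact: component_disjoint.
    by move=> H; rewrite HsP.
  exact: tame_no_contraction.
have fibre_low u v : cmap R u = cmap R v -> u != v -> deg u < 3.
  by move=> e /(fib u v e)[H [_ HP uH _]]; apply: low_comp HP uH.
have lift := min_power_dominating_lift cm fibre_low low inj.
split; first exact: lift.
have [S' minS'] := min_power_dominating_exists (cgraph R).
have [S [minS _ cS]] := lift S' minS'.
by rewrite (gammaP_min minS) (gammaP_min minS').
Qed.
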